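(* Let $R=(r_1,\ldots,r_m)$, $C=(c_1,\ldots,c_n)$ be vectors of positive integers with $\sum_ir_i=\sum_jc_j$, $0<r_i<n$, $0<c_j<m$, and let $W=(w_{ij})$ be an $m\times n$ matrix with entries in $\{0,1\}$. Let $\mathcal{P}(R,C;W)$ be the polytope of real $m\times n$ matrices $X=(x_{ij})$ with row sums $R$, column sums $C$, $0\le x_{ij}\le1$, and $x_{ij}=0$ whenever $w_{ij}=0$, and suppose it contains a matrix $Y=(y_{ij})$ with $0<y_{ij}<1$ whenever $w_{ij}=1$. Let $Z=(z_{ij})$ be the unique maximizer on $\mathcal{P}(R,C;W)$ of $H(X)=\sum_{i,j}\big(x_{ij}\ln\frac1{x_{ij}}+(1-x_{ij})\ln\frac1{1-x_{ij}}\big)$. Let $X=(x_{ij})$ be a random $m\times n$ matrix of independent Bernoulli random variables with $\Pr\{x_{ij}=1\}=z_{ij}$, $\Pr\{x_{ij}=0\}=1-z_{ij}$. Then the probability mass function of $X$ is constant on the set $\Sigma(R,C;W)$ of $m\times n$ 0-1 matrices with row sums $R$, column sums $C$ and $d_{ij}=0$ whenever $w_{ij}=0$; moreover $\Pr\{X=D\}=e^{-H(Z)}$ for all $D\in\Sigma(R,C;W)$.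
   Context: The convention $0\ln\frac10=0$ is used in $H$. *)

(* Defs.v *)
From HB Require Import structures.
From mathcomp Require Import all_boot all_order all_algebra.
From mathcomp Require Import all_classical all_reals all_analysis.

Set Implicit Arguments.
Unset Strict Implicit.
Unset Printing Implicit Defensive.

Import Order.TTheory GRing.Theory Num.Theory.

Local Open Scope classical_set_scope.
Local Open Scope ring_scope.

Section Matrices.
Context {R : realType} {m n : nat}.
Implicit Types (r : 'I_m -> nat) (c : 'I_n -> nat) (W X Z D : 'M[R]_(m, n)).

Definition zero_one W := forall i j, W i j = 0 \/ W i j = 1.

Definition margins r c X :=
  (forall i, \sum_j X i j = (r i)%:R) /\ (forall j, \sum_i X i j = (c j)%:R).

Definition polytope r c W : set 'M[R]_(m, n) :=
  [set X | [/\ margins r c X,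
               forall i j, 0 <= X i j <= 1
             & forall i j, W i j = 0 -> X i j = 0]].

Definition zero_one_tables r c W : set 'M[R]_(m, n) :=
  [set D | [/\ zero_one D,
               margins r c D
             & forall i j, W i j = 0 -> D i j = 0]].

(* At [x = 0] and [x = 1] the convention [0 ln (1/0) = 0] holds because the
   total function [ln] is multiplied by [0]. *)
Definition entropy X : R :=
  \sum_i \sum_j (X i j * ln (1 / X i j)
                 + (1 - X i j) * ln (1 / (1 - X i j))).

Definition entropy_maximizer r c W Z :=
  polytope r c W Z /\ forall X, polytope r c W X -> entropy X <= entropy Z.

End Matrices.

Section RandomMatrix.
Context {d : measure_display} {T : measurableType d} {R : realType}.
Context {P : probability T R}.

Definition mutually_independent (I : finType) (X : I -> {RV P >-> R}) :=
  forall (J : {set I}) (B : I -> set R), (forall i, measurable (B i)) ->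
    P (\bigcap_(i in [set` J]) (X i @^-1` B i))
    = (\prod_(i in J) P (X i @^-1` B i))%E.

Definition bernoulli_rv (X : {RV P >-> R}) (p : R) :=
  P (X @^-1` [set 1]) = p%:E /\ P (X @^-1` [set 0]) = (1 - p)%:E.

Definition matrix_event (m n : nat) (X : 'I_m -> 'I_n -> {RV P >-> R})
    (D : 'M[R]_(m, n)) : set T :=
  [set t | \matrix_(i, j) X i j t = D].

End RandomMatrix.

(* Main.v *)
Require Import Defs.
From mathcomp Require Import all_boot all_order all_algebra.
From mathcomp Require Import all_classical all_reals all_analysis.
From mathcomp Require Import ring lra.
Import Order.TTheory GRing.Theory Num.Theory.
Import numFieldNormedType.Exports.
Local Open Scope classical_set_scope.
Local Open Scope ring_scope.

(** With h the binary entropy function, h'(q) = ln (1 - q) - ln q is infinite at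
    0 and 1, so moving from the maximizer Z towards the interior point Y shows
    that Z is itself interior on the support of W. Stationarity then says that
    sum_ij (x_ij - z_ij) h'(z_ij) = 0 for every X in the polytope; together with
    the strict tangent inequality for h (Gibbs) this gives uniqueness. For a
    0-1 matrix D in the polytope,
      ln Pr(X = D) = sum_ij (ln (1 - z_ij) - d_ij h'(z_ij)),
    where stationarity allows D to be replaced by Z; the result is - H(Z). No
    Lagrange multipliers are needed. *)

(** * Binary entropy: continuity, tangent inequality, blow-up of the slope *)

Section BinaryEntropy.
Context {R : realType}.
Implicit Types (p q x y z t : R).

Definition binary_entropy x : R := x * ln (1 / x) + (1 - x) * ln (1 / (1 - x)).

(** The derivative of [binary_entropy] on (0, 1), given in closed form so that nothing has to be
    differentiated. *)
Definition entropy_slope x : R := ln (1 - x) - ln x.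

Lemma mul_lnV x : x * ln (1 / x) = - (x * ln x).
Proof.
have [x0|x0] := ltP 0 x; first by rewrite div1r lnV ?posrE// mulrN.
by rewrite !ln0 ?mulr0 ?oppr0// div1r invr_le0.
Qed.

Lemma binary_entropyE x :
  binary_entropy x = - (x * ln x) - (1 - x) * ln (1 - x).
Proof. by rewrite /binary_entropy !mul_lnV. Qed.

(* For [x <= 0] both sides vanish. *)
Lemma mul_lnV_le_sqrt x : x * ln (1 / x) <= 2 * Num.sqrt x.
Proof.
have [x0|x0] := ltP 0 x; last first.
  by rewrite mul_lnV ln0// mulr0 oppr0 mulr_ge0 ?sqrtr_ge0.
(* Here x ln (1/x) = 2 s (s ln (1/s)), and ln u < u at u = 1/s bounds the bracket by 1. *)
set s := Num.sqrt x; have s0 : 0 < s by rewrite sqrtr_gt0.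
have -> : x = s ^+ 2 by rewrite sqr_sqrtr// ltW.
rewrite div1r -exprVn lnXn ?invr_gt0//.
have /ltW h : ln s^-1 < s^-1 by rewrite ln_sublinear// invr_gt0.
have : s * (s * ln s^-1) <= s * (s * s^-1) by rewrite !ler_pM2l.
rewrite divff ?gt_eqF// mulr1 -mulr_natl; lra.
Qed.

Lemma continuous_mul_lnV : continuous (fun x : R => x * ln (1 / x)).
Proof.
move=> x; have [x0|x0] := ltP 0 x.
  apply: cvgM; first exact: cvg_id.
  apply: (@continuous_comp _ _ _ (fun y : R => 1 / y) (@ln R)).
    apply: cvgM; first exact: cvg_cst.
    by apply: cvgV; [rewrite gt_eqF|exact: cvg_id].
  by apply: continuous_ln; rewrite div1r invr_gt0.
(* For x <= 0, nearby values lie between 0 and 2 sqrt y, which tends to 0; the lower bound uses y <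
   1. *)
rewrite /continuous_at (_ : x * ln (1 / x) = 0); last by rewrite mul_lnV ln0// mulr0 oppr0.
apply: (@squeeze_cvgr _ _ _ _ (fun=> 0) (fun y => 2 * Num.sqrt y)).
- near=> y; rewrite mul_lnV_le_sqrt andbT mul_lnV.
  have [y0|y0] := ltP 0 y; last by rewrite ln0// mulr0 oppr0.
  rewrite -mulrN mulr_ge0 ?(ltW y0)// oppr_ge0 ln_le0//.
  by apply: ltW; near: y; apply: lt_nbhsl; lra.
- exact: cvg_cst.
- have h : (2 * Num.sqrt y : R) @[y --> x] --> (2 * Num.sqrt x : R).
    by apply: cvgM; [exact: cvg_cst|exact: sqrt_continuous].
  by rewrite ler0_sqrtr// mulr0 in h.
Unshelve. all: by end_near. Qed.

Lemma continuous_binary_entropy : continuous binary_entropy.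
Proof.
move=> x; apply: cvgD; first exact: continuous_mul_lnV.
apply: (@continuous_comp _ _ _ (fun y : R => 1 - y) (fun y => y * ln (1 / y))).
  by apply: cvgB; [exact: cvg_cst|exact: cvg_id].
exact: continuous_mul_lnV.
Qed.

(** For p > 0 this is ln u < u - 1 at u = q / p != 1, multiplied by p. The correction q - p cancels
    when the instances at (p, q) and (1 - p, 1 - q) are added. *)
Lemma mul_lnV_lt p q : 0 <= p -> 0 < q -> p != q ->
  p * ln (1 / p) < - (p * ln q) + (q - p).
Proof.
rewrite le_eqVlt => /orP[/eqP <-|p0] q0 pq; first lra.
have qp0 : 0 < q / p by rewrite divr_gt0.
have : ln (q / p) < q / p - 1.
  have nz : ln (q / p) != 0.
    rewrite ln_eq0//; apply: contraNneq pq => e.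
    by rewrite -[q](divfK (lt0r_neq0 p0)) e mul1r.
  have := expR_gt1Dx nz; rewrite lnK ?posrE//; lra.
rewrite -(ltr_pM2l p0) ln_div ?posrE// mul_lnV !mulrBr mulrCA.
rewrite divff ?gt_eqF// !mulr1; lra.
Qed.

(* Gibbs' inequality, read as strict concavity: the graph lies below its
   tangent at [q]. *)
Lemma binary_entropy_tangent_lt p q : 0 <= p <= 1 -> 0 < q < 1 -> p != q ->
  binary_entropy p < binary_entropy q + (p - q) * entropy_slope q.
Proof.
move=> /andP[p0 p1] /andP[q0 q1] pq.
have h1 := mul_lnV_lt p q p0 q0 pq.
have : (1 - p) * ln (1 / (1 - p)) <
    - ((1 - p) * ln (1 - q)) + ((1 - q) - (1 - p)).
  apply: mul_lnV_lt; [lra|lra|].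
  by apply: contra pq => /eqP e; apply/eqP; lra.
rewrite (binary_entropyE q) /entropy_slope /binary_entropy; lra.
Qed.

Lemma binary_entropy_tangent p q : 0 <= p <= 1 -> 0 < q < 1 ->
  binary_entropy p <= binary_entropy q + (p - q) * entropy_slope q.
Proof.
move=> hp hq; have [->|pq] := eqVneq p q; first by rewrite subrr mul0r addr0.
exact/ltW/binary_entropy_tangent_lt.
Qed.

Lemma entropy_slope_le p q : 0 < p -> p <= q -> q < 1 ->
  entropy_slope q <= entropy_slope p.
Proof.
move=> p0 pq q1; apply: lerB; rewrite ler_ln ?posrE//; lra.
Qed.

Lemma entropy_slopeN x : entropy_slope (1 - x) = - entropy_slope x.
Proof. by rewrite /entropy_slope subKr opprB. Qed.

Lemma continuous_entropy_slope x : 0 < x < 1 ->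
  {for x, continuous entropy_slope}.
Proof.
move=> /andP[x0 x1]; apply: cvgB; last exact: continuous_ln.
apply: (@continuous_comp _ _ _ (fun y : R => 1 - y) (@ln R)).
  by apply: cvgB; [exact: cvg_cst|exact: cvg_id].
by apply: continuous_ln; rewrite subr_gt0.
Qed.

(** The slope along a segment that leaves the boundary value 0 towards y: its entry at time t is t *
    y, and - ln (t * y) grows without bound as t decreases to 0. *)
Lemma entropy_slope_unbounded y M : 0 < y < 1 ->
  exists2 t, 0 < t <= 1 / 2 & M < y * entropy_slope (t * y).
Proof.
(* At t = exp (- s) the slope is at least s - 2, since ln (1 - t y) >= ln (1/2) >= - 2; then y (s -
   2) = |M| + y > M. The constant 3 also ensures t <= 1/2. *)
move=> /andP[y0 y1]; pose s := 3 + `|M| / y.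
have s3 : 3 <= s by rewrite /s lerDl divr_ge0// ltW.
have t0 : 0 < expR (- s) by rewrite expR_gt0.
have t1 : expR (- s) <= 1 / 2.
  rewrite expRN div1r lef_pV2 ?posrE ?expR_gt0//.
  have := expR_ge1Dx s; lra.
exists (expR (- s)); first by rewrite t0.
have ty1 : expR (- s) * y <= 1 / 2.
  by apply: le_trans t1; rewrite ger_pMr// ltW.
rewrite /entropy_slope [ln (_ * _)]lnM ?posrE// expRK.
have h1 : - 2 <= ln (1 - expR (- s) * y).
  apply: le_trans (_ : ln (1 / 2) <= _); last by rewrite ler_ln ?posrE//; lra.
  by rewrite div1r lnV ?posrE// lerN2 ltW// ln_sublinear.
have h2 : ln y <= 0 by rewrite ln_le0// ltW.
apply: (@lt_le_trans _ _ (y * (s - 2))); last by rewrite ler_pM2l//; lra.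
rewrite /s (_ : y * _ = `|M| + y); last by field; rewrite gt_eqF.
by rewrite (le_lt_trans (ler_norm _))// ltrDl.
Qed.

End BinaryEntropy.

(** * The polytope and its entropy maximizer: interiority, stationarity, uniqueness, existence *)

Section EntropyMaximizer.
Context {R : realType} {m n : nat}.
Context (r : 'I_m -> nat) (c : 'I_n -> nat) (W : 'M[R]_(m, n)).
Context (W01 : zero_one W).
Implicit Types (X Y Z D : 'M[R]_(m, n)) (t : R) (p : 'I_m * 'I_n).

Lemma entropyE X : entropy X = \sum_p binary_entropy (X p.1 p.2).
Proof. by rewrite /entropy pair_bigA. Qed.

(** The bounds on the entries are assumed rather than derived by convexity, so that negative t is
    covered as well. *)
Lemma polytope_line Z X t : polytope r c W Z -> polytope r c W X ->
  (forall i j, 0 <= (Z + t *: (X - Z)) i j <= 1) ->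
  polytope r c W (Z + t *: (X - Z)).
Proof.
move=> [[Zr Zc] _ ZW] [[Xr Xc] _ XW] h; split=> //.
  split=> k; under eq_bigr do rewrite !mxE;
    rewrite big_split/= -big_distrr/= big_split/= sumrN.
    by rewrite Zr Xr; lra.
  by rewrite Zc Xc; lra.
by move=> i j Wij; rewrite !mxE ZW// XW// subrr mulr0 addr0.
Qed.

Lemma zero_one_tables_polytope D : zero_one_tables r c W D -> polytope r c W D.
Proof.
move=> [D01 Dm DW]; split=> // i j.
by case: (D01 i j) => ->; rewrite lexx ler01.
Qed.

Definition interior_point X := forall i j, W i j = 1 -> 0 < X i j < 1.

Lemma entropy_tangent X Q : polytope r c W X -> polytope r c W Q ->
  interior_point Q ->
  entropy X <= entropy Q + \sum_p (X p.1 p.2 - Q p.1 p.2) * entropy_slope (Q p.1 p.2).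
Proof.
move=> [_ X01 XW] [_ _ QW] Qint; rewrite !entropyE -big_split/=.
apply: ler_sum => p _; have [Wp|Wp] := W01 p.1 p.2.
  by rewrite XW// QW// subrr mul0r addr0.
by apply: binary_entropy_tangent => //; exact: Qint.
Qed.

(** The equality case of the tangent inequality: an entry where X and Q differ lies on the support
    of W, where the inequality is strict. *)
Lemma entropy_tangent_eq X Q : polytope r c W X -> polytope r c W Q ->
  interior_point Q ->
  entropy Q + \sum_p (X p.1 p.2 - Q p.1 p.2) * entropy_slope (Q p.1 p.2) <= entropy X ->
  X = Q.
Proof.
move=> hX hQ Qint; rewrite !entropyE -big_split/= => le; apply: contrapT => XQ.
have [i [j ij]] : exists i j, X i j <> Q i j.
  apply: contrapT => h; apply: XQ; apply/matrixP => i j.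
  by apply: contrapT => hij; apply: h; exists i, j.
move: le; apply/negP; rewrite -ltNge.
have [[_ X01 XW] [_ _ QW]] := (hX, hQ).
rewrite (bigD1 (i, j))//= [ltRHS](bigD1 (i, j))//=; apply: ltr_leD.
  have [Wij|Wij] := W01 i j; first by case: ij; rewrite XW// QW.
  by apply: binary_entropy_tangent_lt => //; [exact: Qint|exact/eqP].
apply: ler_sum => p _; have [Wp|Wp] := W01 p.1 p.2.
  by rewrite XW// QW// subrr mul0r addr0.
by apply: binary_entropy_tangent => //; exact: Qint.
Qed.

(** The tangent is taken at the interior point Q = Z + t (X - Z), because Z may still lie on the
    boundary. Compare H(Z) <= H(Q) + tangent term with H(Q) <= H(Z), and use Z - Q = - t (X - Z). *)
Lemma maximizer_slope_le0 Z X t : entropy_maximizer r c W Z ->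
  polytope r c W X -> 0 < t <= 1 -> interior_point (Z + t *: (X - Z)) ->
  \sum_p (X p.1 p.2 - Z p.1 p.2) * entropy_slope ((Z + t *: (X - Z)) p.1 p.2) <= 0.
Proof.
move=> [ZP Zmax] XP /andP[t0 t1] Qint; set Q := Z + _.
have QP : polytope r c W Q.
  apply: polytope_line => // i j; rewrite !mxE.
  have [_ /(_ i j) Z01 _] := ZP; have [_ /(_ i j) X01 _] := XP; nra.
have le := le_trans (entropy_tangent _ _ ZP QP Qint)
  (lerD (Zmax _ QP) (lexx _)).
have eS : \sum_p (Z p.1 p.2 - Q p.1 p.2) * entropy_slope (Q p.1 p.2) =
    - t * \sum_p (X p.1 p.2 - Z p.1 p.2) * entropy_slope (Q p.1 p.2).
  by rewrite big_distrr/=; apply: eq_bigr => p _; rewrite !mxE; ring.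
by move: le; rewrite eS lerDl mulNr oppr_ge0 pmulr_rle0.
Qed.

(** On the segment from Z to Y the sum of the terms [F t p] is at most 0 and each term is bounded
    below, so each is also bounded above uniformly in t. A boundary entry of Z on the support would
    make its term unbounded as t tends to 0. *)
Lemma maximizer_interior Z Y : entropy_maximizer r c W Z ->
  polytope r c W Y -> interior_point Y -> interior_point Z.
Proof.
move=> Zmax YP Yint i j Wij; have [ZP _] := Zmax.
have [_ Z01 ZW] := ZP; have [_ _ YW] := YP.
pose Q t := Z + t *: (Y - Z).
have QE t p : Q t p.1 p.2 = Z p.1 p.2 + t * (Y p.1 p.2 - Z p.1 p.2).
  by rewrite !mxE.
have Qint t : 0 < t <= 1 -> interior_point (Q t).
  move=> t01 k l Wkl; have := Yint k l Wkl; have := Z01 k l.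
  rewrite (QE t (k, l))/=; nra.
pose F t p := (Y p.1 p.2 - Z p.1 p.2) * entropy_slope (Q t p.1 p.2).
(* Since the slope is decreasing, [F t p] is nonincreasing in t whatever the sign of Y - Z. *)
have F_le t p : 0 < t <= 1 / 2 -> F (1 / 2) p <= F t p.
  move=> t2; rewrite /F; have [Wp|Wp] := W01 p.1 p.2.
    by rewrite ZW// YW// subrr !mul0r.
  have /andP[Qt0 Qt1] : 0 < Q t p.1 p.2 < 1 by apply: Qint => //; lra.
  have /andP[Qh0 Qh1] : 0 < Q (1 / 2) p.1 p.2 < 1 by apply: Qint => //; lra.
  have [ZY|YZ] := leP (Z p.1 p.2) (Y p.1 p.2).
    rewrite ler_wpM2l ?subr_ge0// entropy_slope_le// !QE; nra.
  rewrite ler_wnM2l ?subr_le0 ?(ltW YZ)// entropy_slope_le// !QE; nra.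
pose K := F (1 / 2) (i, j) - \sum_p F (1 / 2) p.
have F_bound t : 0 < t <= 1 / 2 -> F t (i, j) <= K.
  move=> t2; have : \sum_p F t p <= 0.
    by apply: maximizer_slope_le0 => //; [lra|apply: Qint; lra].
  have : \sum_(p | p != (i, j)) F (1 / 2) p <= \sum_(p | p != (i, j)) F t p.
    by apply: ler_sum => p _; exact: F_le.
  have E u : \sum_p F u p = F u (i, j) + \sum_(p | p != (i, j)) F u p.
    by rewrite (bigD1 (i, j)).
  by rewrite /K !E; lra.
have /andP[y0 y1] := Yint i j Wij; have /andP[z0 z1] := Z01 i j.
apply/andP; split; rewrite lt_neqAle ?z0 ?z1 andbT; apply/negP => /eqP Zij.
  have [|t t2] := entropy_slope_unbounded (Y i j) K; first by rewrite y0.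
  apply/negP; rewrite -leNgt; have := F_bound t t2.
  by rewrite /F QE/= -Zij subr0 add0r.
(* The entry 1 reduces to the entry 0 by the symmetry x -> 1 - x, under which the slope is odd. *)
have [|t t2] := entropy_slope_unbounded (1 - Y i j) K; first lra.
apply/negP; rewrite -leNgt; have := F_bound t t2.
rewrite /F QE/= Zij (_ : 1 + _ = 1 - t * (1 - Y i j)); last by ring.
by rewrite entropy_slopeN mulrN -mulNr opprB.
Qed.

(** The limit t -> 0+ of [maximizer_slope_le0]: the slope is continuous at the entries of Z on the
    support, and elsewhere the factor X - Z is 0. *)
Lemma maximizer_slope_at_le0 Z X : entropy_maximizer r c W Z ->
  interior_point Z -> polytope r c W X ->
  \sum_p (X p.1 p.2 - Z p.1 p.2) * entropy_slope (Z p.1 p.2) <= 0.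
Proof.
move=> Zmax Zint XP; have [ZP _] := Zmax.
have [_ _ ZW] := ZP; have [_ X01 XW] := XP.
pose F t := \sum_p (X p.1 p.2 - Z p.1 p.2)
  * entropy_slope (Z p.1 p.2 + t * (X p.1 p.2 - Z p.1 p.2)).
have -> : \sum_p (X p.1 p.2 - Z p.1 p.2) * entropy_slope (Z p.1 p.2) = F 0.
  by apply: eq_bigr => p _; rewrite mul0r addr0.
have Fcvg : F t @[t --> 0^'+] --> F 0.
  apply: cvg_at_right_filter; apply: cvg_big => [|p _]; first exact: add_continuous.
  have [Wp|Wp] := W01 p.1 p.2.
    rewrite XW// ZW// subrr; under eq_cvg do rewrite mul0r.
    by rewrite mul0r; exact: cvg_cst.
  apply: cvgM; first exact: cvg_cst.
  apply: (@continuous_comp _ _ _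
    (fun t => Z p.1 p.2 + t * (X p.1 p.2 - Z p.1 p.2)) entropy_slope).
    apply: cvgD; first exact: cvg_cst.
    by apply: cvgM; [exact: cvg_id|exact: cvg_cst].
  by apply: continuous_entropy_slope; rewrite mul0r addr0; exact: Zint.
apply: (cvgr_to_le Fcvg); near=> t.
have t01 : 0 < t < 1.
  by apply/andP; split; near: t; [exact: nbhs_right_gt|apply: nbhs_right_lt].
have -> : F t = \sum_p (X p.1 p.2 - Z p.1 p.2)
    * entropy_slope ((Z + t *: (X - Z)) p.1 p.2).
  by apply: eq_bigr => p _; rewrite !mxE.
apply: maximizer_slope_le0 => //; first lra.
move=> i j Wij; rewrite !mxE; have := Zint i j Wij; have := X01 i j; nra.
Unshelve. all: by end_near. Qed.

(* An interior maximizer can also be left in the direction [Z - X], so the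
   first-order inequality is an equality. *)
Lemma maximizer_slope_eq0 Z X : entropy_maximizer r c W Z ->
  interior_point Z -> polytope r c W X ->
  \sum_p (X p.1 p.2 - Z p.1 p.2) * entropy_slope (Z p.1 p.2) = 0.
Proof.
move=> Zmax Zint XP; have [ZP _] := Zmax.
have [_ _ ZW] := ZP; have [_ X01 XW] := XP.
(* The product e of these weights, all in (0, 1], is positive and below each of them. On the support
   e <= z (1 - z) <= min (z, 1 - z), so z - e (x - z) stays in [0, 1]. *)
pose w p := if W p.1 p.2 == 0 then 1 else Z p.1 p.2 * (1 - Z p.1 p.2).
have w01 p : 0 < w p <= 1.
  rewrite /w; case: eqVneq => [_|Wp]; first by rewrite ltr01 lexx.
  have : W p.1 p.2 = 1 by case: (W01 p.1 p.2) Wp => // ->; rewrite eqxx.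
  by move=> /Zint; nra.
pose e := \prod_p w p.
have e0 : 0 < e by apply: prodr_gt0 => p _; have /andP[] := w01 p.
have e_le p : e <= w p.
  have /andP[w0 w1] := w01 p; rewrite /e (bigD1 p)//= ger_pMr//.
  by apply: prodr_ile1 => q _; have /andP[/ltW -> ->] := w01 q.
apply/eqP; rewrite eq_le maximizer_slope_at_le0//=.
have X'P : polytope r c W (Z + (- e) *: (X - Z)).
  apply: polytope_line => // i j; rewrite !mxE.
  have [Wij|Wij] := W01 i j.
    by rewrite XW// ZW// subrr mulr0 addr0 lexx ler01.
  have := e_le (i, j); rewrite /w /= Wij oner_eq0.
  have := Zint i j Wij; have := X01 i j => /andP[x0 x1] /andP[z0 z1] le; nra.
have := maximizer_slope_at_le0 _ _ Zmax Zint X'P.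
rewrite (eq_bigr (fun p =>
  - e * ((X p.1 p.2 - Z p.1 p.2) * entropy_slope (Z p.1 p.2)))).
  by rewrite -big_distrr/= mulNr oppr_le0 pmulr_rge0.
by move=> p _; rewrite !mxE; ring.
Qed.

(** Stationarity at Z reduces the tangent bound on H(Z') to H(Z), which Z' attains; the equality
    case applies. *)
Lemma maximizer_unique Z Z' : interior_point Z ->
  entropy_maximizer r c W Z -> entropy_maximizer r c W Z' -> Z = Z'.
Proof.
move=> Zint Zmax [Z'P Z'max]; have [ZP _] := Zmax; apply/esym.
apply: entropy_tangent_eq => //; rewrite maximizer_slope_eq0// addr0.
exact: Z'max.
Qed.

(** Extreme value theorem. Matrices are flattened to row vectors, where the polytope is a closed
    subset of the compact cube. *)
Lemma maximizer_exists : polytope r c W !=set0 ->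
  exists Z, entropy_maximizer r c W Z.
Proof.
move=> [Y YP]; pose A := [set v : 'rV[R]_(m * n) | polytope r c W (vec_mx v)].
have coord i j : continuous (fun v : 'rV[R]_(m * n) => vec_mx v i j).
  have -> : (fun v : 'rV[R]_(m * n) => vec_mx v i j) =
      fun v => v ord0 (mxvec_index i j) by apply/funext => v; rewrite mxE.
  exact: coord_continuous.
have A0 : A !=set0 by exists (mxvec Y); rewrite /A/= mxvecK.
have closed_level (f : 'rV[R]_(m * n) -> R) a :
    continuous f -> closed [set v | f v = a].
  by move=> /continuous_closedP cf; have := cf [set x | x = a] (@closed_eq R a).
have cont_sum (I : finType) (k : I -> 'I_m) (l : I -> 'I_n) :
    continuous (fun v : 'rV[R]_(m * n) => \sum_a vec_mx v (k a) (l a)).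
  by apply: continuous_big => [|a _]; [exact: add_continuous|exact: coord].
have Acompact : compact A.
  have -> : A = [set v : 'rV[R]_(m * n) | forall k, `[0, 1]%classic (v ord0 k)] `&`
      (\bigcap_i [set v | \sum_j vec_mx v i j = (r i)%:R] `&`
       (\bigcap_j [set v | \sum_i vec_mx v i j = (c j)%:R] `&`
        \bigcap_(p in [set p | W p.1 p.2 = 0]) [set v | vec_mx v p.1 p.2 = 0])).
    apply/seteqP; split=> v.
      move=> [[vr vc] v01 vW]; split; last first.
        split; first by move=> i _; exact: vr.
        by split; [move=> j _; exact: vc|move=> p; exact: vW].
      move=> k; case/mxvec_indexP: k => i j.
      by have := v01 i j; rewrite mxE /= in_itv.
    move=> [v01 [vr [vc vW]]]; split.
    - by split=> k; [exact: vr|exact: vc].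
    - by move=> i j; have := v01 (mxvec_index i j); rewrite mxE /= in_itv.
    - by move=> i j Wij; exact: (vW (i, j)).
  apply: compact_closedI.
    apply: (@rV_compact R _ (fun=> `[0, 1]%classic)) => k.
    exact: segment_compact.
  apply: closedI.
    by apply: closed_bigI => i _; apply: closed_level; exact: cont_sum.
  apply: closedI.
    by apply: closed_bigI => j _; apply: closed_level; exact: cont_sum.
  by apply: closed_bigI => p _; apply: closed_level; exact: coord.
have [v vA vmax] : exists2 v, v \in A &
    forall u, u \in A -> entropy (vec_mx u) <= entropy (vec_mx v).
  apply: (@compact_EVT_max _ _ (fun u => entropy (vec_mx u))) => //.
  apply: continuous_subspaceT.
  have -> : (fun u : 'rV[R]_(m * n) => entropy (vec_mx u)) =
      fun u => \sum_p binary_entropy (vec_mx u p.1 p.2).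
    by apply/funext => u; exact: entropyE.
  apply: continuous_big => [|p _ u]; first exact: add_continuous.
  apply: (@continuous_comp _ _ _ (fun v => vec_mx v p.1 p.2) binary_entropy).
    exact: coord.
  exact: continuous_binary_entropy.
exists (vec_mx v); split; first by rewrite inE in vA.
move=> X XP; have := vmax (mxvec X); rewrite mxvecK; apply.
by rewrite inE /A/= mxvecK.
Qed.
End EntropyMaximizer.

(** * The probability of a given 0-1 matrix *)

Section BernoulliMatrix.
Context {d : measure_display} {T : measurableType d} {R : realType}.
Context {P : probability T R} {m n : nat}.
Context (X : 'I_m -> 'I_n -> {RV P >-> R}).

Lemma matrix_event_prob (D : 'M[R]_(m, n)) :
  mutually_independent (fun ij : 'I_m * 'I_n => X ij.1 ij.2) ->
  P (matrix_event X D) = (\prod_p P (X p.1 p.2 @^-1` [set D p.1 p.2]))%E.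
Proof.
move=> /(_ [set: 'I_m * 'I_n]%SET (fun p => [set D p.1 p.2])) indep.
have -> : matrix_event X D = \bigcap_(p in [set` [set: 'I_m * 'I_n]%SET])
    (X p.1 p.2 @^-1` [set D p.1 p.2]).
  apply/seteqP; split=> t /=.
    by move=> <- p _ /=; rewrite mxE.
  move=> h; apply/matrixP => i j; rewrite mxE.
  by apply: (h (i, j)); rewrite /= inE.
rewrite indep; first by apply: eq_bigl => p; rewrite inE.
by move=> p; exact: measurable_set1.
Qed.

(* At [z = 0] the slope is a junk value, which the factor [x = 0] discards. *)
Lemma bernoulli_rv_prob (Y : {RV P >-> R}) (z x : R) :
  bernoulli_rv Y z -> x = 0 \/ x = 1 -> 0 < z < 1 \/ x = 0 /\ z = 0 ->
  P (Y @^-1` [set x]) = (expR (ln (1 - z) - x * entropy_slope z))%:E.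
Proof.
move=> [Y1 Y0] x01 [/andP[z0 z1]|[-> z0]]; last first.
  by rewrite Y0 z0 mul0r !subr0 ln1 expR0.
case: x01 => ->; rewrite ?Y1 ?Y0; congr (_%:E).
  by rewrite mul0r subr0 lnK// posrE subr_gt0.
by rewrite mul1r /entropy_slope subKr lnK.
Qed.

End BernoulliMatrix.

Theorem theorem2p5 (R : realType) (m n : nat)
    (r : 'I_m -> nat) (c : 'I_n -> nat) (W : 'M[R]_(m, n))
    (hrc : (\sum_i r i = \sum_j c j)%N)
    (hr : forall i, (0 < r i < n)%N)
    (hc : forall j, (0 < c j < m)%N)
    (hW : zero_one W)
    (hY : exists Y : 'M[R]_(m, n), polytope r c W Y /\
            forall i j, W i j = 1 -> 0 < Y i j < 1) :
  (exists! Z : 'M[R]_(m, n), entropy_maximizer r c W Z) /\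
  forall Z : 'M[R]_(m, n), entropy_maximizer r c W Z ->
  forall (d : measure_display) (T : measurableType d) (P : probability T R)
         (X : 'I_m -> 'I_n -> {RV P >-> R}),
    mutually_independent (fun ij : 'I_m * 'I_n => X ij.1 ij.2) ->
    (forall i j, bernoulli_rv (X i j) (Z i j)) ->
    (forall D D' : 'M[R]_(m, n),
       zero_one_tables r c W D -> zero_one_tables r c W D' ->
       P (matrix_event X D) = P (matrix_event X D')) /\
    (forall D : 'M[R]_(m, n), zero_one_tables r c W D ->
       P (matrix_event X D) = (expR (- entropy Z))%:E).
Proof.
have [Y [YP Yint]] := hY.
have int Z : entropy_maximizer r c W Z -> interior_point W Z.
  by move=> Zmax; exact: (maximizer_interior _ _ _ hW _ _ Zmax YP Yint).
split.
  have [|Z Zmax] := maximizer_exists r c W; first by exists Y.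
  exists Z; split=> // Z' Z'max.
  exact: (maximizer_unique _ _ _ hW _ _ (int _ Zmax) Zmax Z'max).
move=> Z Zmax d T P X indep bern.
suff main D : zero_one_tables r c W D ->
    P (matrix_event X D) = (expR (- entropy Z))%:E.
  by split=> // D D' /main -> /main ->.
move=> Dtab; have [D01 _ DW] := Dtab; have [[_ _ ZW] _] := Zmax.
rewrite matrix_event_prob//.
rewrite (eq_bigr (fun p => (expR (ln (1 - Z p.1 p.2)
    - D p.1 p.2 * entropy_slope (Z p.1 p.2)))%:E)); last first.
  move=> p _; apply: bernoulli_rv_prob => //.
  (* Off the support D and Z both vanish, which is the degenerate case. *)
  have [Wp|Wp] := hW p.1 p.2; first by right; rewrite DW ?ZW.
  by left; exact: int.
rewrite prodEFin -expR_sum; congr (expR _)%:E.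
have := maximizer_slope_eq0 _ _ _ hW _ _ Zmax (int _ Zmax)
  (zero_one_tables_polytope _ _ _ _ Dtab).
(* Adding the vanishing sum of (d - z) h'(z) turns each ln (1 - z) - d h'(z) into ln (1 - z) - z
   h'(z) = - h(z). *)
rewrite entropyE -sumrN => slope0; rewrite -[LHS]addr0 -[X in _ + X]slope0 -big_split/=.
apply: eq_bigr => p _; rewrite binary_entropyE /entropy_slope; ring.
Qed.
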